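(* Let $\tau\in\mathbb{Z}$ and let $m_1,m_2\geq 1$ be integers. Define $$n_{(m_1,m_2)}(\tau)=\frac{1}{m_1+m_2}\sum_{d\mid m_1,\ d\mid m_2}\mu(d)\,(-1)^{(m_1+m_2)(\tau+1)/d}\binom{(m_1\tau+m_1)/d-1}{m_1/d}\binom{(m_2\tau+m_2)/d}{m_2/d},$$ where $\mu$ is the Möbius function and the sum runs over positive common divisors $d$ of $m_1,m_2$. Then $n_{(m_1,m_2)}(\tau)\in\mathbb{Z}$.
   Context: For integers $b\geq 0$ and $a\in\mathbb{Z}$ the binomial coefficient is defined by: $\binom{a}{b}=1$ if $b=0$; $\binom{a}{b}$ is the usual binomial coefficient if $b\geq 1$ and $a\geq 0$; and $\binom{a}{b}=(-1)^b\binom{-a+b-1}{b}$ if $b\geq1$ and $a<0$. *)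

(* Defs.v *)
From mathcomp Require Import all_boot all_order all_algebra.
Set Implicit Arguments. Unset Strict Implicit. Unset Printing Implicit Defensive.
Import Order.TTheory GRing.Theory Num.Theory.
Local Open Scope ring_scope.

Definition binz (a : int) (b : nat) : int :=
  if b == 0%N then 1
  else match a with
       | Posz n => ('C(n, b))%:Z
       | Negz _ => (-1) ^+ b * ('C(absz (- a + b%:Z - 1)%R, b))%:Z
       end.

Definition mobius (n : nat) : int :=
  if n == 0%N then 0
  else if all (fun p => logn p n == 1%N) (primes n)
       then (-1) ^+ size (primes n) else 0.

Definition n_m1m2 (m1 m2 : nat) (tau : int) : rat :=
  (m1 + m2)%:R^-1 *
  \sum_(d <- divisors m1 | (d %| m2)%N)
     ((mobius d)%:~R
      * (-1) ^ (((m1 + m2)%:Z * (tau + 1))%R %/ d%:Z)%Z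
      * (binz (((m1%:Z * tau + m1%:Z)%R %/ d%:Z)%Z - 1) (m1 %/ d)%N)%:~R
      * (binz ((m2%:Z * tau + m2%:Z)%R %/ d%:Z)%Z (m2 %/ d)%N)%:~R).

(* Main.v *)
(* Put t = tau + 1 >= 1; the case tau < 0 reduces to it by reflecting t to
   1 - t and exchanging m1 and m2. For a, b >= 1 let
   f(a, b) = (-1)^((a + b) t) C(a t - 1, a) C(b t, b), so that the sum runs over
   mu(d) f(m1 / d, m2 / d). By Legendre's formula and a count of carries,
   a + b divides f(a, b) gcd(a, b). For a prime p, removing the factors divisible
   by p from the products defining the binomials gives
   U f(pa, pb) = f(a, b) V with p not dividing U and V congruent to U modulo
   p gcd(a, b) up to a sign which only matters when p = 2 and a + b is odd; hence
   the p-part of p (a + b) divides f(pa, pb) - f(a, b). If p does not divide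
   gcd(m1, m2), the first fact shows that the p-part of m1 + m2 divides each
   term; otherwise the second fact shows that it divides the sum of the terms
   of index d and p d, for every d prime to p. *)
Require Import Defs.
From mathcomp Require Import all_boot all_order all_algebra.
From mathcomp Require Import zify ring.
Import Order.TTheory GRing.Theory Num.Theory.
Local Open Scope ring_scope.

(** * Valuations of factorials and carries *)

(** The terms with [k > n] vanish. A bound [N] shared by all the valuations, here and in the next
    lemma, lets them be compared one power of [p] at a time. *)
Lemma logn_fact_widen (p n N : nat) : prime p -> (n <= N)%N ->
  logn p n`! = (\sum_(1 <= k < N.+1) n %/ p ^ k)%N.
Proof.
move=> pp nN; rewrite logn_fact // [RHS](@big_cat_nat _ _ _ n.+1) //=.
rewrite [X in (_ + X)%N]big_nat_cond [X in (_ + X)%N]big1 ?addn0 // => k.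
case/andP=> /andP[nk _] _; apply: divn_small.
by apply: ltn_trans nk (ltn_expl _ (prime_gt1 pp)).
Qed.

Lemma logn_count_dvd_widen (p n N : nat) : prime p -> (0 < n <= N)%N ->
  logn p n = (\sum_(1 <= k < N.+1) (p ^ k %| n))%N.
Proof.
move=> pp /andP[n0 nN]; rewrite logn_count_dvd //.
rewrite [RHS](@big_cat_nat _ _ _ n) //=; last lia.
rewrite [X in (_ + X)%N]big_nat_cond [X in (_ + X)%N]big1 ?addn0 // => k.
case/andP=> /andP[nk _] _; rewrite gtnNdvd //.
by apply: leq_ltn_trans nk (ltn_expl _ (prime_gt1 pp)).
Qed.

(* If [q] divides [a + b] but not [a], then [q] also divides [x + y + 1], so
   that the residues of [b] and [y] are [q - a] and [q - 1 - x]: exactly one of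
   the additions [a + x] and [b + y] produces a carry modulo [q]. *)
Lemma divn_carry (q a b x y : nat) :
  (0 < q)%N -> (q %| a + b -> q %| (x + y).+1)%N ->
  (a %/ q + x %/ q + b %/ q + y %/ q + (q %| a + b)
   <= (a + x) %/ q + (b + y) %/ q + (q %| gcdn a b))%N.
Proof.
move=> q0 hxy; rewrite !divnD // dvdn_gcd.
have [qab|] := boolP (q %| a + b)%N; last by lia.
have := hxy qab; rewrite /dvdn -addnS -modnDm => /eqP hxy'.
move: qab; rewrite /dvdn -modnDm => /eqP.
have := ltn_pmod a q0; have := ltn_pmod b q0.
have := ltn_pmod x q0; have := ltn_pmod y q0.
have : ((x %% q + (y %% q).+1) %% q = 0)%N.
  by rewrite -hxy' -[in RHS]addn1 -[in RHS](modnDml y) addn1 modnDmr.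
move: (a %% q)%N (b %% q)%N (x %% q)%N (y %% q)%N => {hxy hxy'} r s u v.
move=> h1 vq uq sq rq h2.
have [k hk] : exists k, (u + v.+1 = k * q)%N by apply/dvdnP/eqP.
have [l hl] : exists l, (r + s = l * q)%N by apply/dvdnP/eqP.
clear h1 h2.
have {}hk : (u + v.+1 = q)%N by case: k hk => [|[|k]]; rewrite ?mulSn; lia.
have [r0|r0] := eqVneq r 0%N.
  have s0 : s = 0%N by case: l hl => [|l]; rewrite ?mulSn; lia.
  by rewrite r0 s0 !eqxx; lia.
have {}hl : (r + s = q)%N by case: l hl => [|[|l]]; rewrite ?mulSn; lia.
case: (leqP q (r + u)); case: (leqP q (s + v)); lia.
Qed.

(** For [t <= 1] a binomial vanishes. Otherwise the lower complements [x = a (t - 1) - 1] and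
    [y = b (t - 1)] satisfy [x + y + 1 = (a + b) (t - 1)], so [divn_carry] applies to each power of
    each prime. *)
Lemma addn_dvd_bin (t a b : nat) : (0 < a)%N -> (0 < b)%N ->
  (a + b %| 'C((a * t).-1, a) * 'C(b * t, b) * gcdn a b)%N.
Proof.
move=> a0 b0; case: t => [|[|t]]; first by rewrite !muln0 (bin_small b0) muln0.
  by rewrite bin_small ?mul0n // muln1 prednK.
set x := (a * t.+1).-1; set y := (b * t.+1)%N.
have -> : ((a * t.+2).-1 = a + x)%N by rewrite /x; nia.
have -> : (b * t.+2 = b + y)%N by rewrite /y; nia.
have CA : (0 < 'C(a + x, a))%N by rewrite bin_gt0; lia.
have CB : (0 < 'C(b + y, b))%N by rewrite bin_gt0; lia.
have g0 : (0 < gcdn a b)%N by rewrite gcdn_gt0 a0.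
apply/dvdn_partP => [|p]; first by lia.
rewrite mem_primes => /and3P[pp _ _]; rewrite p_part.
rewrite pfactor_dvdn ?muln_gt0 ?CA ?CB //.
rewrite !lognM ?muln_gt0 ?CA ?CB //.
set N := (a + x + b + y)%N.
have eA : (logn p (a + x)`! = logn p 'C(a + x, a) + (logn p a`! + logn p x`!))%N.
  by rewrite -(@bin_fact (a + x) a) ?leq_addr // addKn !lognM ?muln_gt0 ?CA ?fact_gt0.
have eB : (logn p (b + y)`! = logn p 'C(b + y, b) + (logn p b`! + logn p y`!))%N.
  by rewrite -(@bin_fact (b + y) b) ?leq_addr // addKn !lognM ?muln_gt0 ?CB ?fact_gt0.
have gN : (gcdn a b <= N)%N by have := dvdn_leq a0 (dvdn_gcdl a b); rewrite /N; lia.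
move: eA eB; rewrite !(@logn_fact_widen p _ N) //; try by rewrite /N; lia.
rewrite (@logn_count_dvd_widen p (a + b) N) //; last by rewrite /N; lia.
rewrite (@logn_count_dvd_widen p (gcdn a b) N) ?g0 //.
move=> eA eB.
suff : (\sum_(1 <= k < N.+1) (a %/ p ^ k + x %/ p ^ k + b %/ p ^ k + y %/ p ^ k
   + (p ^ k %| a + b)) <= \sum_(1 <= k < N.+1) ((a + x) %/ p ^ k + (b + y) %/ p ^ k
   + (p ^ k %| gcdn a b)))%N.
  by rewrite !big_split /=; lia.
apply: leq_sum => k _; apply: divn_carry; first by rewrite expn_gt0 prime_gt0.
have -> : ((x + y).+1 = (a + b) * t.+1)%N by rewrite /x /y; nia.
exact: dvdn_mulr.
Qed.

(** * Products with the multiples of p removed *)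

(* The product of [F j] over the [1 <= j <= p * a] not divisible by [p], written
   [j = p * i + r.+1]. *)
Definition prod_ndvd (p a : nat) (F : nat -> int) : int :=
  \prod_(i < a) \prod_(r < p.-1) F (p * i + r.+1)%N.

Lemma prod_ndvdM (p a : nat) (F : nat -> int) : (0 < p)%N ->
  \prod_(i < p * a) F i.+1 =
  prod_ndvd p a F * \prod_(i < a) F (p * i.+1)%N.
Proof.
case: p => // p _; elim: a => [|a IH]; first by rewrite muln0 /prod_ndvd !big_ord0 mulr1.
rewrite mulnSr big_split_ord /= IH big_ord_recr /= /prod_ndvd !big_ord_recr /=.
rewrite -addnS -mulnSr.
under [X in _ * (X * _) = _]eq_bigr => i _ do rewrite -addnS.
ring.
Qed.

Lemma coprime_prod_ndvd (p a k : nat) : prime p ->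
  coprimez (p ^ k)%N%:Z (prod_ndvd p a Posz).
Proof.
move=> pp.
have -> : prod_ndvd p a Posz = (\prod_(i < a) \prod_(r < p.-1) (p * i + r.+1))%N%:Z.
  rewrite /prod_ndvd -!natz natr_prod; apply: eq_bigr => i _.
  by rewrite natr_prod; apply: eq_bigr => r _; rewrite natz.
rewrite coprimezE; apply: coprimeXl.
apply: (big_ind (coprime p)) => [|u v cu cv|i _];
  rewrite ?coprimen1 ?coprimeMr ?cu //.
apply: (big_ind (coprime p)) => [|u v cu cv|r _];
  rewrite ?coprimen1 ?coprimeMr ?cu //.
rewrite prime_coprime // dvdn_addr ?dvdn_mulr // gtnNdvd //.
by have := ltn_ord r; have := prime_gt0 pp; lia.
Qed.

(** Each of the [a * p.-1] factors [n - j] is congruent to [- j]. *)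
Lemma prod_ndvd_sub_mod (p a : nat) (n d : int) : (d %| n)%Z ->
  (prod_ndvd p a (fun j => n - j%:Z) = (-1) ^+ (a * p.-1) * prod_ndvd p a Posz %[mod d])%Z.
Proof.
move=> dn; apply/eqP; rewrite eqz_mod_dvd /prod_ndvd.
have -> : (-1) ^+ (a * p.-1) * \prod_(i < a) \prod_(r < p.-1) (p * i + r.+1)%N%:Z =
   \prod_(i < a) \prod_(r < p.-1) (- (p * i + r.+1)%N%:Z).
  under [RHS]eq_bigr => i _ do rewrite prodrN card_ord.
  by rewrite big_split /= prodr_const card_ord -exprM mulnC.
have dvd_prod m (F G : 'I_m -> int) : (forall i, (d %| F i - G i)%Z) ->
    (d %| \prod_(i < m) F i - \prod_(i < m) G i)%Z.
  move=> FG; elim/big_rec2: _ => [|i x y _ IH]; first by rewrite subrr.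
  have -> : F i * y - G i * x = (F i - G i) * y + G i * (y - x) by ring.
  by apply: rpredD; [exact: dvdz_mulr | exact: dvdz_mull].
apply: (dvd_prod) => i; apply: (dvd_prod) => r.
by rewrite opprK subrK.
Qed.

Lemma bin_prod_sub (t n : nat) : (0 < t)%N ->
  ('C((n * t).-1, n) * n`!)%N%:Z = \prod_(i < n) ((n * t)%N%:Z - i.+1%:Z).
Proof.
move=> t0; rewrite bin_ffact ffact_prod -natz natr_prod; apply: eq_bigr => i _.
by rewrite natz; have := ltn_ord i; nia.
Qed.

(** In the numerator and in [(p * n)!] alike, the multiples of [p] contribute [p ^ n] times the
    corresponding product for [n]; the common factor [p ^ n * n!] then cancels. *)
Lemma bin_mulp (p t n : nat) : (0 < p)%N -> (0 < t)%N ->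
  'C((p * n * t).-1, p * n)%:Z * prod_ndvd p n Posz =
  'C((n * t).-1, n)%:Z * prod_ndvd p n (fun j => (p * n * t)%N%:Z - j%:Z).
Proof.
move=> p0 t0; have pn0 : (p ^ n * n`!)%N%:Z != 0.
  by rewrite -lt0n muln_gt0 expn_gt0 p0 fact_gt0.
have fact_prod m : m`!%:Z = \prod_(i < m) i.+1%:Z.
  by rewrite fact_prod big_add1 big_mkord -natz natr_prod; apply: eq_bigr => i; rewrite natz.
apply: (mulIf pn0).
have pow (G : nat -> int) : \prod_(i < n) (p%:Z * G i) = (p ^ n)%N%:Z * \prod_(i < n) G i.
  by rewrite big_split prodr_const card_ord /= -[(p ^ n)%N%:Z]natz natrX natz.
have := @bin_prod_sub t (p * n) t0; rewrite PoszM fact_prod.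
rewrite (prod_ndvdM _ _ Posz) // (prod_ndvdM _ _ (fun j => (p * n * t)%N%:Z - j%:Z)) //.
under eq_bigr => i _ do rewrite PoszM.
rewrite (pow (fun i => i.+1%:Z)) -fact_prod.
under [in RHS]eq_bigr => i _ do rewrite -mulnA !(PoszM p) -mulrBr.
rewrite (pow (fun i => (n * t)%N%:Z - i.+1%:Z)) -bin_prod_sub // !PoszM => e.
by apply: etrans (etrans _ e) _; ring.
Qed.

Lemma bin_mul_pred (t n : nat) : (0 < n)%N ->
  (t.+1 * 'C((n * t.+1).-1, n) = t * 'C(n * t.+1, n))%N.
Proof.
move=> n0; apply/eqP; rewrite -(eqn_pmul2l n0) !mulnA mul_bin_down.
by rewrite mulnS addKn.
Qed.

(** By [bin_mul_pred] the ratio of this binomial to the one in [bin_mulp] depends on [t] only, hence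
    is the same for [n] and [p * n]. *)
Lemma bin_mulp_succ (p t n : nat) : (0 < p)%N -> (0 < t)%N -> (0 < n)%N ->
  'C(p * n * t.+1, p * n)%:Z * prod_ndvd p n Posz =
  'C(n * t.+1, n)%:Z * prod_ndvd p n (fun j => (p * n * t.+1)%N%:Z - j%:Z).
Proof.
move=> p0 t0 n0; have tz : t%:Z != 0 by rewrite -lt0n.
apply: (mulfI tz); rewrite !mulrA -!PoszM -!bin_mul_pred ?muln_gt0 ?p0 //.
by rewrite !(PoszM t.+1) -!mulrA bin_mulp.
Qed.

(** * Divisibility of single terms and of their differences *)

(* With [t = tau + 1], [a = m1 / d] and [b = m2 / d], the term of index [d]
   without its factor [mu d]. *)
Definition annulus (t a b : nat) : int :=
  (-1) ^+ ((a + b) * t) * 'C((a * t).-1, a)%:Z * 'C(b * t, b)%:Z.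

Lemma annulus_dvd (t a b : nat) : (0 < a)%N -> (0 < b)%N ->
  ((a + b)%N%:Z %| annulus t a b * (gcdn a b)%:Z)%Z.
Proof.
move=> a0 b0; rewrite /annulus -!mulrA; apply: dvdz_mull; rewrite -!PoszM mulnA.
exact: addn_dvd_bin.
Qed.

Lemma annulus0 (t a b : nat) : (0 < a)%N -> (0 < b)%N -> (t <= 1)%N ->
  annulus t a b = 0.
Proof.
rewrite /annulus; case: t => [|[|//]] a0 b0 _.
  by rewrite !muln0 (bin_small b0) mulr0.
by rewrite !muln1 bin_small ?mulr0 ?mul0r // prednK.
Qed.

Lemma annulus_mulp_sub (t p a b k : nat) : prime p -> (0 < a)%N -> (0 < b)%N ->
  (p ^ k %| p * (a + b))%N ->
  ((p ^ k)%N%:Z %| annulus t (p * a) (p * b) - annulus t a b)%Z.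
Proof.
move=> pp a0 b0 pk; have p0 := prime_gt0 pp.
have [t1|] := leqP t 1%N; first by rewrite !annulus0 ?muln_gt0 ?p0 // subrr dvdz0.
case: t => [//|t] t0.
set U := prod_ndvd p a Posz * prod_ndvd p b Posz.
set V := prod_ndvd p a (fun j => (p * a * t.+1)%N%:Z - j%:Z)
       * prod_ndvd p b (fun j => (p * b * t.+1)%N%:Z - j%:Z).
rewrite -(@Gauss_dvdzr _ U); last first.
  by rewrite coprimezMr !coprime_prod_ndvd.
set s := (-1) ^+ ((p * a + p * b) * t.+1) : int.
set s' := (-1) ^+ ((a + b) * t.+1) : int.
have -> : U * (annulus t.+1 (p * a) (p * b) - annulus t.+1 a b) =
   'C((a * t.+1).-1, a)%:Z * 'C(b * t.+1, b)%:Z * (s * V - s' * U).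
  have eA := @bin_mulp p t.+1 a p0 isT.
  have eB := @bin_mulp_succ p t b p0 t0 b0.
  rewrite mulrBr /annulus -/s -/s'.
  have -> : U * (s * 'C((p * a * t.+1).-1, p * a)%:Z * 'C(p * b * t.+1, p * b)%:Z) =
    s * ('C((p * a * t.+1).-1, p * a)%:Z * prod_ndvd p a Posz)
      * ('C(p * b * t.+1, p * b)%:Z * prod_ndvd p b Posz) by rewrite /U; ring.
  by rewrite eA eB /V; ring.
set g := (p * gcdn a b)%N.
(* The relative sign of [s * V] and [s' * U] modulo [g]: the last summand of the exponent comes from
   [prod_ndvd_sub_mod]. *)
set e := (-1) ^+ ((p * a + p * b) * t.+1 + (a + b) * t.+1 + (a + b) * p.-1) : int.
have gV : (g%:Z %| s * V - e * s' * U)%Z.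
  have ga : (g%:Z %| (p * a * t.+1)%N%:Z)%Z.
    by rewrite dvdzE /= /g dvdn_mulr // dvdn_pmul2l // dvdn_gcdl.
  have gb : (g%:Z %| (p * b * t.+1)%N%:Z)%Z.
    by rewrite dvdzE /= /g dvdn_mulr // dvdn_pmul2l // dvdn_gcdr.
  rewrite -eqz_mod_dvd -modzMmr.
  rewrite -[(V %% _)%Z]modzMm (prod_ndvd_sub_mod p a _ _ ga) (prod_ndvd_sub_mod p b _ _ gb).
  rewrite modzMm modzMmr; apply/eqP; congr modz.
  have ss : s' * s' = 1 by rewrite -expr2 sqrr_sign.
  rewrite /e /U (mulnDl a b p.-1) !exprD -/s -/s'.
  move: s s' ss => s1 s2 ss; set x := (-1) ^+ (a * _); set y := (-1) ^+ (b * _).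
  move: x y (prod_ndvd p a Posz) (prod_ndvd p b Posz) => x y P Q.
  have -> : s1 * s2 * (x * y) * s2 * (P * Q) = s1 * (s2 * s2) * (x * y) * (P * Q) by ring.
  rewrite ss; ring.
have [e1|] := boolP (odd ((p * a + p * b) * t.+1 + (a + b) * t.+1 + (a + b) * p.-1)).
  (* The exponent is [(a + b) * ((p + 1) * t.+1 + p - 1)], which is even for odd [p]. *)
  have [p2 oab] : p = 2%N /\ odd (a + b).
    move: e1; rewrite -mulnDr !oddD !oddM -!oddD.
    case: (even_prime pp) => [->|op] /=; first by case: (odd _).
    by rewrite -[p.-1]subn1 oddB // op /=; case: (odd _); case: (odd _).
  (* Only parity is left to check, and modulo 2 the wrong sign is harmless. *)
  have k2 : (p ^ k %| 2)%N.
    have cop : coprime (p ^ k) (a + b) by apply: coprimeXl; rewrite p2 coprime2n.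
    by rewrite -(Gauss_dvdl 2%N cop) -p2.
  rewrite dvdz_mull //; apply: (@dvdz_trans 2) => //.
  have -> : s * V - s' * U = s * V - e * s' * U - 2 * s' * U.
    by rewrite /e -signr_odd e1 expr1; ring.
  apply: rpredB; last by rewrite -mulrA dvdz_mulr.
  by apply: dvdz_trans gV; rewrite /g p2 PoszM dvdz_mulr.
move=> e0; have {e0} e1 : e = 1 by rewrite /e -signr_odd (negPf e0).
rewrite e1 mul1r in gV.
(* The factor [g = p * gcdn a b] of [s * V - s' * U] supplies both [p] and the gcd required by
   [addn_dvd_bin]. *)
apply: (@dvdz_trans (p * (a + b))%N%:Z); first by [].
have /dvdzP[w ->] := gV.
rewrite mulrCA dvdz_mull // /g !PoszM mulrCA dvdz_mul //.
have := addn_dvd_bin t.+1 a b a0 b0.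
by rewrite -[_%:Z * _]PoszM -PoszM.
Qed.

(** * Möbius function and sums over divisors *)

Lemma mobius_mulp (p d : nat) : prime p -> ~~ (p %| d)%N -> (0 < d)%N ->
  mobius (p * d) = - mobius d.
Proof.
move=> pp pd d0; have p0 := prime_gt0 pp; have pd0 : (0 < p * d)%N by rewrite muln_gt0 p0.
have np : p \notin primes d by rewrite mem_primes pp d0.
have pe : perm_eq (primes (p * d)) (p :: primes d).
  apply: uniq_perm; rewrite ?primes_uniq //= ?np ?primes_uniq // => q.
  by rewrite primesM // primes_prime // !inE.
rewrite /mobius (gtn_eqF pd0) (gtn_eqF d0).
rewrite (perm_all _ pe) (perm_size pe) /= lognM // logn_prime // eqxx.
rewrite (_ : logn p d = 0)%N ?addn0 /=; last by rewrite lognE pp d0 (negPf pd).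
rewrite (@eq_in_all _ _ (fun q => logn q d == 1%N)).
  by case: ifP; rewrite ?oppr0 // exprS mulN1r.
move=> q qd; have qp : (q == p) = false by apply: contraNF np => /eqP <-.
by rewrite (lognM q p0 d0) (logn_prime q pp) eq_sym qp.
Qed.

Lemma mobius_sqr (p d : nat) : prime p -> (p ^ 2 %| d)%N -> mobius d = 0.
Proof.
move=> pp p2d; rewrite /mobius; case: eqVneq => // d0.
have d1 : (0 < d)%N by rewrite lt0n.
have : (2 <= logn p d)%N by rewrite -pfactor_dvdn.
case: allP => // /(_ p); rewrite mem_primes pp d1 (dvdn_trans _ p2d) ?dvdn_exp //=.
by move=> /(_ isT) /eqP ->.
Qed.

(** Multiplication by [p] maps the divisors of [g] prime to [p] bijectively onto those divisible by
    [p] exactly once; the other multiples of [p] contribute nothing. *)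
Lemma divisors_sum_mulp (p g : nat) (F : nat -> int) :
  prime p -> (0 < g)%N -> (p %| g)%N ->
  (forall d, (p ^ 2 %| d)%N -> F d = 0) ->
  \sum_(d <- divisors g | (p %| d)%N) F d =
  \sum_(d <- divisors g | ~~ (p %| d)%N) F (p * d)%N.
Proof.
move=> pp g0 pg F0; have p0 := prime_gt0 pp.
rewrite (bigID (fun d => (p ^ 2 %| d)%N)) /= big1 ?add0r => [|d /andP[_]]; last exact: F0.
rewrite -big_filter -[RHS]big_filter -(big_map (muln p) xpredT F) /=.
apply: perm_big; apply: uniq_perm.
- by rewrite filter_uniq ?divisors_uniq.
- rewrite map_inj_uniq ?filter_uniq ?divisors_uniq // => x y /eqP.
  by rewrite eqn_pmul2l // => /eqP.
move=> d; rewrite mem_filter -dvdn_divisors //; apply/idP/mapP.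
  case/andP=> /andP[/dvdnP[c ->] p2] dg; exists c; last exact: mulnC.
  rewrite mem_filter -dvdn_divisors // (dvdn_trans _ dg) ?dvdn_mulr // andbT.
  by move: p2; rewrite expnS expn1 dvdn_pmul2r.
case=> c; rewrite mem_filter -dvdn_divisors // => /andP[pc cg] ->.
rewrite dvdn_mulr // expnS expn1 dvdn_pmul2l // pc /=.
by rewrite Gauss_dvd ?pg // prime_coprime.
Qed.

Lemma annulus_sum_dvd (t m1 m2 : nat) : (0 < m1)%N -> (0 < m2)%N ->
  ((m1 + m2)%N%:Z %|
   \sum_(d <- divisors (gcdn m1 m2)) mobius d * annulus t (m1 %/ d) (m2 %/ d))%Z.
Proof.
move=> m1p m2p; set g := gcdn m1 m2.
have g0 : (0 < g)%N by rewrite gcdn_gt0 m1p.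
have quot d : d \in divisors g -> [/\ (0 < d)%N, (d %| g)%N & exists a b,
    [/\ m1 = (d * a)%N, m2 = (d * b)%N, (0 < a)%N & (0 < b)%N]].
  rewrite -dvdn_divisors // => dg; have d0 := dvdn_gt0 g0 dg.
  split=> //; have /dvdnP[a e1] := dvdn_trans dg (dvdn_gcdl m1 m2).
  have /dvdnP[b e2] := dvdn_trans dg (dvdn_gcdr m1 m2).
  exists a, b; split; [lia | lia | |].
    by move: m1p; rewrite e1; case: (a).
  by move: m2p; rewrite e2; case: (b).
rewrite dvdzE; apply/dvdn_partP => [|p]; first by rewrite addn_gt0 m1p.
rewrite mem_primes => /and3P[pp _ _]; rewrite p_part.
have p0 := prime_gt0 pp.
have pk := pfactor_dvdnn p (m1 + m2); move: (logn _ _) pk => k pk.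
set S := bigop.body _ _ _; suff : ((p ^ k)%N%:Z %| S)%Z by [].
have [pg|pg] := boolP (p %| g)%N; last first.
  rewrite /S big_seq; apply: rpred_sum => d /quot[d0 dg [a [b [e1 e2 a0 b0]]]].
  apply: dvdz_mull; rewrite e1 e2 !mulKn //.
  have cg : coprimez (p ^ k)%N%:Z g%:Z.
    by rewrite coprimezE; apply: coprimeXl; rewrite prime_coprime.
  (* Since [g = d * gcdn a b] and [m1 + m2 = d * (a + b)], multiplying the term by [g] reduces the
     goal to [annulus_dvd]. *)
  rewrite -(Gauss_dvdzl _ cg); apply: (@dvdz_trans (m1 + m2)%N%:Z) => //.
  rewrite /g e1 e2 -muln_gcdr -mulnDr !PoszM mulrCA dvdz_mul //.
  exact: annulus_dvd.
rewrite /S (bigID (fun d => (p %| d)%N)) /= divisors_sum_mulp //; last first.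
  by move=> d pd; rewrite (mobius_sqr p) // mul0r.
rewrite -big_split /= big_seq_cond; apply: rpred_sum => d /andP[dg pd].
have [d0 {}dg _] := quot d dg.
have : (p * d)%N \in divisors g.
  by rewrite -dvdn_divisors // Gauss_dvd ?pg // prime_coprime.
case/quot=> pd0 _ [a [b [e1 e2 a0 b0]]].
rewrite mobius_mulp // e1 e2 !mulKn // ![(p * d)%N]mulnC -!mulnA !mulKn //.
(* The indices [d] and [p * d] have opposite Möbius values, so together they give [mobius d] times a
   difference as in [annulus_mulp_sub]. *)
rewrite mulNr addrC -mulrBr; apply: dvdz_mull.
apply: annulus_mulp_sub => //.
have cd : coprime (p ^ k) d by apply: coprimeXl; rewrite prime_coprime.
by rewrite -(Gauss_dvdr _ cd) mulnA [(d * p)%N]mulnC mulnDr -e1 -e2.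
Qed.

(** * From integer binomials to natural ones *)

Lemma binz_nat (n b : nat) : binz n b = 'C(n, b)%:Z.
Proof. by rewrite /binz; case: eqP => // ->; rewrite bin0. Qed.

Lemma binz_opp (n b : nat) : (0 < n)%N ->
  binz (- n%:Z) b = (-1) ^+ b * 'C((n + b).-1, b)%:Z.
Proof.
case: n => // n _; rewrite -NegzE /binz; case: eqP => [->|_]; first by rewrite bin0 mul1r.
by congr (_ * ('C(_, _))%:Z); lia.
Qed.

Lemma n_m1m2_term_pos (t m1 m2 d : nat) : (0 < m1)%N -> (0 < m2)%N ->
  (d %| m1)%N -> (d %| m2)%N ->
  ((-1) ^ (((m1 + m2)%N%:Z * (t%:Z + 1)) %/ d%:Z)%Z
      * (binz (((m1%:Z * t%:Z + m1%:Z)%R %/ d%:Z)%Z - 1) (m1 %/ d)%N)%:~R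
      * (binz ((m2%:Z * t%:Z + m2%:Z)%R %/ d%:Z)%Z (m2 %/ d)%N)%:~R) =
  (annulus t.+1 (m1 %/ d) (m2 %/ d))%:~R :> rat.
Proof.
move=> m1p m2p /dvdnP[a e1] /dvdnP[b e2].
have d0 : (0 < d)%N by move: m1p; rewrite e1 muln_gt0 => /andP[].
have a0 : (0 < a)%N by move: m1p; rewrite e1 muln_gt0 => /andP[].
have dz : d%:Z != 0 by rewrite -lt0n.
rewrite e1 e2 !mulnK //.
have -> : (a * d + b * d)%N%:Z * (t%:Z + 1) = ((a + b) * t.+1)%N%:Z * d%:Z by lia.
have -> : (a * d)%N%:Z * t%:Z + (a * d)%N%:Z = (a * t.+1)%N%:Z * d%:Z by lia.
have -> : (b * d)%N%:Z * t%:Z + (b * d)%N%:Z = (b * t.+1)%N%:Z * d%:Z by lia.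
rewrite !mulzK // (_ : (a * t.+1)%N%:Z - 1 = (a * t.+1).-1%:Z); last by nia.
by rewrite !binz_nat /annulus !rmorphM rmorphXn rmorphN1.
Qed.

(** Reflection turns the upper arguments [- a t - 1] and [- b t] into [a (t + 1)] and
    [b (t + 1) - 1], which exchanges the two kinds of binomial; its sign [(-1) ^ (a + b)] raises the
    exponent [(a + b) t] to [(a + b) (t + 1)]. *)
Lemma n_m1m2_term_neg (t m1 m2 d : nat) : (0 < m1)%N -> (0 < m2)%N ->
  (d %| m1)%N -> (d %| m2)%N ->
  ((-1) ^ (((m1 + m2)%N%:Z * (Negz t + 1)) %/ d%:Z)%Z
      * (binz (((m1%:Z * Negz t + m1%:Z)%R %/ d%:Z)%Z - 1) (m1 %/ d)%N)%:~R
      * (binz ((m2%:Z * Negz t + m2%:Z)%R %/ d%:Z)%Z (m2 %/ d)%N)%:~R) =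
  (annulus t.+1 (m2 %/ d) (m1 %/ d))%:~R :> rat.
Proof.
move=> m1p m2p /dvdnP[a e1] /dvdnP[b e2].
have d0 : (0 < d)%N by move: m1p; rewrite e1 muln_gt0 => /andP[].
have a0 : (0 < a)%N by move: m1p; rewrite e1 muln_gt0 => /andP[].
have b0 : (0 < b)%N by move: m2p; rewrite e2 muln_gt0 => /andP[].
have dz : d%:Z != 0 by rewrite -lt0n.
rewrite e1 e2 !mulnK // NegzE.
have -> : (a * d + b * d)%N%:Z * (- t.+1%:Z + 1) = - ((a + b) * t)%N%:Z * d%:Z by lia.
have -> : (a * d)%N%:Z * - t.+1%:Z + (a * d)%N%:Z = - (a * t)%N%:Z * d%:Z by lia.
have -> : (b * d)%N%:Z * - t.+1%:Z + (b * d)%N%:Z = - (b * t)%N%:Z * d%:Z by lia.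
rewrite !mulzK // (_ : - (a * t)%N%:Z - 1 = - (a * t).+1%:Z); last by lia.
rewrite binz_opp // addSn -mulnSr /=.
have -> : binz (- (b * t)%N%:Z) b = (-1) ^+ b * 'C((b * t.+1).-1, b)%:Z.
  (* At [t = 0] the upper argument is 0, outside the reflected range, but both sides vanish. *)
  case: (posnP t) => [->|t0]; last by rewrite binz_opp ?muln_gt0 ?b0 // mulnSr.
  by rewrite muln0 muln1 oppr0 binz_nat !bin_small ?mulr0 // prednK.
rewrite -exprnN /annulus !rmorphM !rmorphXn !rmorphN1 /=.
rewrite -exprVn invrN1 (_ : (b + a) * t.+1 = (a + b) * t + a + b)%N ?exprD; last by lia.
ring.
Qed.

Theorem theorem1p3 (tau : int) (m1 m2 : nat) (hm1 : (1 <= m1)%N) (hm2 : (1 <= m2)%N) :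
  n_m1m2 m1 m2 tau \is a Num.int.
Proof.
have m12 : (m1 + m2)%:R != 0 :> rat by rewrite pnatr_eq0; lia.
have g0 : (0 < gcdn m1 m2)%N by rewrite gcdn_gt0 hm1.
have -> : n_m1m2 m1 m2 tau = (m1 + m2)%:R^-1 *
    (\sum_(d <- divisors (gcdn m1 m2)) mobius d *
      match tau with Posz t => annulus t.+1 (m1 %/ d) (m2 %/ d)
                   | Negz t => annulus t.+1 (m2 %/ d) (m1 %/ d) end)%:~R.
  rewrite /n_m1m2; congr (_ * _); rewrite -big_filter rmorph_sum /=.
  have pe : perm_eq [seq d <- divisors m1 | (d %| m2)%N] (divisors (gcdn m1 m2)).
    apply: uniq_perm; rewrite ?filter_uniq ?divisors_uniq // => d.
    by rewrite mem_filter -!dvdn_divisors // dvdn_gcd andbC.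
  rewrite (perm_big _ pe) /= big_seq [RHS]big_seq; apply: eq_bigr => d.
  rewrite -dvdn_divisors // dvdn_gcd => /andP[d1 d2]; rewrite rmorphM /= -!mulrA.
  congr (_ * _); rewrite !mulrA; case: tau => t.
    exact: n_m1m2_term_pos.
  exact: n_m1m2_term_neg.
set S := bigop.body _ _ _.
have /dvdzP[q ->] : ((m1 + m2)%N%:Z %| S)%Z.
  rewrite /S; case: tau {S} => t; first exact: annulus_sum_dvd.
  by rewrite gcdnC addnC; exact: annulus_sum_dvd.
by rewrite rmorphM /= mulrCA -pmulrn mulVf // mulr1 intr_int.
Qed.
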